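(* For all integers $\omega,\epsilon,p_1,p_2,n\ge0$ there is a bijection $$\psi:\mathcal{D}^*(\omega,\epsilon,p_1,p_2,n)\to\mathcal{D}(\omega,\epsilon,p_1,p_2,n-2(\omega+2\epsilon)),$$ and consequently, for all $m,n\ge 0$, a bijection $\psi:\mathcal{D}^*(m,n)\to\mathcal{D}(m,n-2m)$.
   Context: A Schur partition is a partition of an integer into positive parts such that consecutive parts differ by at least $3$, and no two consecutive parts differing by exactly $3$ are both multiples of $3$. For a partition $\pi$, $m(\pi)$ is the number of parts plus the number of even parts. Upper pairs: in a Schur partition $\pi$, a part $x$ is in an upper pair if $x+3$ or $x-3$ is also a part, except when (i) $x$ is odd and is the largest element of an odd-length maximal arithmetic progression of parts of $\pi$ with common difference $3$, or (ii) $x$ is even and is the smallest element of such an odd-length maximal progression. Lower pairs: a part $x>1$ is in a lower pair if $x+3$ or $x-3$ is also a part, except when (i) $x$ is even and is the largest element of an odd-length maximal arithmetic progression with common difference $3$ of parts greater than $1$, or (ii) $x$ is odd and is the smallest element of such a progression. $\mathcal{D}^*(\omega,\epsilon,p_1,p_2,n)$ is the set of Schur partitions of $n$ in which every odd part is $\ge3$ and every even part is $\ge6$, having $\omega$ odd parts, $\epsilon$ even parts, $p_1$ parts that lie in upper pairs and are $\equiv1\pmod3$, and $p_2$ parts that lie in upper pairs and are $\equiv 2\pmod 3$. $\mathcal{D}(\omega,\epsilon,p_1,p_2,n)$ is the set of Schur partitions of $n$ with $\omega$ odd parts, $\epsilon$ even parts, $p_1$ parts that lie in lower pairs and are $\equiv1\pmod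 3$, and $p_2$ parts that lie in lower pairs and are $\equiv2\pmod3$. $\mathcal{D}(m,n)$ is the set of Schur partitions $\pi$ of $n$ with $m(\pi)=m$, and $\mathcal{D}^*(m,n)$ its subset in which every odd part is $\ge 3$ and every even part is $\ge 6$. Sets with negative $n$ are empty. *)

(* Defs.v *)
From mathcomp Require Import all_boot all_order all_algebra.

Set Implicit Arguments.
Unset Strict Implicit.
Unset Printing Implicit Defensive.

(* A partition is the decreasing sequence of its parts. *)
Definition is_partition (lam : seq nat) : bool :=
  sorted geq lam && all (leq 1) lam.

Definition even (x : nat) : bool := ~~ odd x.

(* Conditions on consecutive parts [a] (the larger one) and [b]. *)
Definition schur_rel (a b : nat) : bool :=
  (b + 3 <= a) && ~~ [&& a == b + 3, 3 %| a & 3 %| b].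

Definition is_schur (lam : seq nat) : bool :=
  is_partition lam && sorted schur_rel lam.

Definition odd_parts (lam : seq nat) : nat := count odd lam.
Definition even_parts (lam : seq nat) : nat := count even lam.

Definition mstat (lam : seq nat) : nat := size lam + even_parts lam.

(* The progression a, a + 3, ..., a + 3 (l - 1) is a maximal one in [s]: it is
   nonempty, contained in [s], and cannot be extended upwards or downwards. *)
Definition maxprog3 (s : seq nat) (a l : nat) : bool :=
  [&& 0 < l, all (fun i => a + 3 * i \in s) (iota 0 l),
      a + 3 * l \notin s & a \notin [seq y + 3 | y <- s]].

(* Bounding the length by [size s] loses nothing: the terms of the progression
   are distinct elements of [s]. *)
Definition min_odd_prog (s : seq nat) (x : nat) : bool :=
  [exists l : 'I_(size s).+1, odd l && maxprog3 s x l].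

Definition max_odd_prog (s : seq nat) (x : nat) : bool :=
  has (fun a => [exists l : 'I_(size s).+1,
         [&& odd l, maxprog3 s a l & x == a + 3 * l.-1]]) s.

(* [x + 3] or [x - 3] is a part; the second is written without truncated
   subtraction. *)
Definition has_neighbour (lam : seq nat) (x : nat) : bool :=
  (x + 3 \in lam) || (x \in [seq y + 3 | y <- lam]).

Definition in_upper_pair (lam : seq nat) (x : nat) : bool :=
  [&& x \in lam, has_neighbour lam x,
      ~~ (odd x && max_odd_prog lam x) & ~~ (even x && min_odd_prog lam x)].

(* The neighbour of [x] may be the part 1, but the progressions only involve
   the parts greater than 1. *)
Definition in_lower_pair (lam : seq nat) (x : nat) : bool :=
  let lam' := [seq y <- lam | 1 < y] in
  [&& x \in lam, 1 < x, has_neighbour lam x,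
      ~~ (even x && max_odd_prog lam' x) & ~~ (odd x && min_odd_prog lam' x)].

Definition upper_count (r : nat) (lam : seq nat) : nat :=
  count (fun x => in_upper_pair lam x && (x == r %[mod 3])) lam.

Definition lower_count (r : nat) (lam : seq nat) : nat :=
  count (fun x => in_lower_pair lam x && (x == r %[mod 3])) lam.

Definition min_parts (lam : seq nat) : bool :=
  all (fun x => if odd x then 3 <= x else 6 <= x) lam.

(* Partitioned number: an integer, so that there is no partition of [n] when
   [n] is negative. *)
Definition is_schur_of (n : int) (lam : seq nat) : bool :=
  is_schur lam && (Posz (sumn lam) == n).

Definition Dstar_refined (w e p1 p2 : nat) (n : int) : Type :=
  {lam : seq nat | [&& is_schur_of n lam, min_parts lam,
                      odd_parts lam == w, even_parts lam == e,
                      upper_count 1 lam == p1 & upper_count 2 lam == p2]}.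

Definition D_refined (w e p1 p2 : nat) (n : int) : Type :=
  {lam : seq nat | [&& is_schur_of n lam,
                      odd_parts lam == w, even_parts lam == e,
                      lower_count 1 lam == p1 & lower_count 2 lam == p2]}.

Definition D (m : nat) (n : int) : Type :=
  {lam : seq nat | is_schur_of n lam && (mstat lam == m)}.

Definition Dstar (m : nat) (n : int) : Type :=
  {lam : seq nat | [&& is_schur_of n lam, mstat lam == m & min_parts lam]}.

(* Main.v *)
Require Import Defs.
From mathcomp Require Import all_boot all_order all_algebra zify.

Set Implicit Arguments.
Unset Strict Implicit.
Unset Printing Implicit Defensive.

(* A maximal progression of length l and difference 3 has 2 [l / 2] parts in
   upper pairs, and as many in lower pairs, all in the same residue class.  So
   both counts can be read off the greedy pairing, which goes down from the
   largest part and pairs x with x - 3 whenever possible.  After subtracting from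
   every single 4 for each single and 6 for each pair below it, and from every
   pair (y + 3, y) 3 for each single and 6 for each pair below it, the singles
   and the pairs become two arbitrary multisets, the latter without multiples of
   3: their relative order is forced, and the sum of the partition is the sum of
   the data plus a function of the numbers of singles and pairs.  The bijection
   lowers odd singles by 2, even singles by 4 and pairs by 3 per part; a part 3
   in the source becomes a part 1 in the target. *)

(** * Encoding Schur partitions by singles and pairs *)

(** With the pair on top, its lower part is at least 3 above the part of [t] exactly when
    [t + size T' <= z]; with the single on top, its distance to the pair is at least 4 exactly when
    this fails. So the order is forced. *)
Definition pair_on_top (T : seq nat) (z : nat) : bool :=
  if T is t :: T' then t + size T' <= z else true.

(* A single [t] with [k] singles and [l] pairs below it becomes the part
   [t + 4 k + 6 l]; a pair [z] becomes the parts [y] and [y + 3] with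
   [y = z + 3 k + 6 l]. *)
Fixpoint enc (T : seq nat) : seq nat -> seq nat :=
  fix enc_T (Z : seq nat) : seq nat :=
    match Z with
    | z :: Z' =>
        if pair_on_top T z then
          let y := z + 3 * size T + 6 * size Z' in [:: y + 3, y & enc_T Z']
        else if T is t :: T' then t + 4 * size T' + 6 * size Z :: enc T' Z
        else [::]
    | [::] => if T is t :: T' then t + 4 * size T' :: enc T' [::] else [::]
    end.

(* On Schur partitions none of these truncated subtractions is negative. *)
Fixpoint dec (s : seq nat) : seq nat * seq nat :=
  match s with
  | x :: ((y :: s2) as s1) =>
      if x == y + 3 then
        let: (T, Z) := dec s2 in (T, y - 3 * size T - 6 * size Z :: Z)
      else let: (T, Z) := dec s1 in (x - 4 * size T - 6 * size Z :: T, Z)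
  | [:: x] => ([:: x], [::])
  | [::] => ([::], [::])
  end.

(** The lower parts of the greedy pairs, left unshifted for the counting modulo 3. *)
Fixpoint pairs (s : seq nat) : seq nat :=
  match s with
  | x :: ((y :: s2) as s1) => if x == y + 3 then y :: pairs s2 else pairs s1
  | _ => [::]
  end.

Definition single_on_top (t : nat) (T Z : seq nat) : bool :=
  if Z is z :: _ then z < t + size T else true.

Lemma enc_single t T Z : single_on_top t T Z ->
  enc (t :: T) Z = t + 4 * size T + 6 * size Z :: enc T Z.
Proof.
case: Z => [_|z Z] /=; first by rewrite muln0 addn0.
by rewrite ltnNge => /negbTE->.
Qed.

Lemma enc_pair T z Z : pair_on_top T z ->
  enc T (z :: Z) = [:: z + 3 * size T + 6 * size Z + 3,
                      z + 3 * size T + 6 * size Z & enc T Z].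
Proof. by case: T => [_|t T] //= ->. Qed.

(** Follows the two recursive branches of [enc], by induction on the total length of both lists. *)
Lemma enc_ind (P : seq nat -> seq nat -> Prop) :
  P [::] [::] ->
  (forall t T Z, single_on_top t T Z -> P T Z -> P (t :: T) Z) ->
  (forall T z Z, pair_on_top T z -> P T Z -> P T (z :: Z)) ->
  forall T Z, P T Z.
Proof.
move=> P0 PS PP T Z.
have [n] := ubnP (size T + size Z); elim: n T Z => // n IH [|t T] [|z Z] //= hn.
- by apply: PP => //; apply: IH => /=; lia.
- by apply: PS => //; apply: IH => /=; lia.
- have [h|h] := leqP (t + size T) z; first by apply: PP => //; apply: IH => /=; lia.
  by apply: PS => //; apply: IH => /=; lia.
Qed.

(** The parts of a pair differ by exactly 3, so they are not multiples of 3; since [y - z] is a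
    multiple of 3, neither is [z]. *)
Definition is_code (c : seq nat * seq nat) : bool :=
  [&& sorted geq c.1, sorted geq c.2 & all (fun z => ~~ (3 %| z)) c.2].

Lemma sorted_geq_cons t T :
  sorted geq (t :: T) = (if T is t' :: _ then t' <= t else true) && sorted geq T.
Proof. by case: T. Qed.

Lemma enc_spec T Z :
  [\/ T = [::] /\ Z = [::],
      exists t T', T = t :: T' /\ single_on_top t T' Z |
      exists z Z', Z = z :: Z' /\ pair_on_top T z].
Proof.
case: T Z => [|t T] [|z Z]; [by constructor 1 | | |].
- by constructor 3; exists z, Z.
- by constructor 2; exists t, T.
- have [h|h] := leqP (t + size T) z; first by constructor 3; exists z, Z.
  by constructor 2; exists t, T.
Qed.

(** The coefficient 4 handles a single below, the strict inequality in [single_on_top] a pair below.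
    A gap of 4 keeps the greedy pairing from using the single. *)
Lemma single_gap t T Z : sorted geq (t :: T) -> single_on_top t T Z ->
  if enc T Z is y :: _ then y + 4 <= t + 4 * size T + 6 * size Z else true.
Proof.
rewrite sorted_geq_cons => /andP[ht _] hz.
case: (enc_spec T Z) => [[-> ->]//|[t' [T' [E h]]]|[z [Z' [E h]]]]; subst.
  by rewrite enc_single //=; lia.
by rewrite enc_pair //; move: hz => /=; lia.
Qed.

Lemma pair_gap T z Z : sorted geq (z :: Z) -> pair_on_top T z ->
  if enc T Z is y :: _ then y + 3 <= z + 3 * size T + 6 * size Z else true.
Proof.
rewrite sorted_geq_cons => /andP[hz _] ht.
case: (enc_spec T Z) => [[-> ->]//|[t [T' [E h]]]|[z' [Z' [E h]]]]; subst.
  by rewrite enc_single //; move: ht => /=; lia.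
by rewrite enc_pair //=; lia.
Qed.

Lemma sorted_schur_cons x s :
  sorted schur_rel s -> (if s is y :: _ then schur_rel x y else true) ->
  sorted schur_rel (x :: s).
Proof. by case: s => //= y s -> ->. Qed.

(** The gaps make [dec] recognise each single and each pair as it was placed; residues survive
    because pairs are shifted by multiples of 3. *)
Lemma enc_correct T Z : is_code (T, Z) ->
  [/\ sorted schur_rel (enc T Z), dec (enc T Z) = (T, Z) &
      map (modn^~ 3) (pairs (enc T Z)) = map (modn^~ 3) Z].
Proof.
move: T Z; apply: enc_ind => // [t T Z hz IH|T z Z hz IH];
  rewrite /is_code [_.1]/= [_.2]/=.
  case/and3P=> hT hZ h3.
  have [] := IH; first by rewrite /is_code h3 hZ (path_sorted hT).
  rewrite enc_single //; have := single_gap hT hz.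
  case: (enc T Z) => [_ _ [<- <-]|y s] //; first by rewrite /= !muln0 !addn0.
  move=> hy hs E Ep; split.
  - by apply: sorted_schur_cons => //; rewrite /schur_rel; lia.
  - rewrite [LHS]/= ifN; last by lia.
    by rewrite -/(dec (y :: s)) E; congr (_ :: _, _); lia.
  - by rewrite [pairs _]/= ifN //; lia.
case/and3P=> hT hZ /= /andP[hz3 h3].
have [] := IH; first by rewrite /is_code /= h3 (path_sorted hZ) hT.
rewrite enc_pair //; have := pair_gap hZ hz => hg hs E Ep; split.
(* No part of the pair is a multiple of 3, so a difference of exactly 3 is allowed inside it and
   just below it. *)
- apply: sorted_schur_cons; last by rewrite /schur_rel; lia.
  apply: sorted_schur_cons => //.
  by case: (enc T Z) hg => // y s; rewrite /schur_rel; lia.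
- by rewrite /= eqxx E; congr (_, _ :: _); lia.
- by rewrite /= eqxx /= Ep; congr (_ :: _); lia.
Qed.

(** By induction the tail is [enc T Z], which begins with a single or with the upper part of a pair;
    comparing the head with that part gives the order, the bound [c] and the position of the new
    entry. *)
Lemma dec_correct c s : all (leq c) s -> sorted schur_rel s ->
  [/\ is_code (dec s), enc (dec s).1 (dec s).2 = s,
      all (leq c) (dec s).1 & all (leq c) (dec s).2].
Proof.
have [n] := ubnP (size s); elim: n s => // n IH [|x [|y s]] //= hn.
  by rewrite muln0 !addn0 => ->.
case/and3P=> hx hy hs /andP[hxy hp]; case: eqP => [exy|nxy].
  have [] := IH s _ hs (path_sorted hp); first by lia.
  case: (dec s) => T Z /= /and3P[/= hT hZ h3] E hcT hcZ.
  have hy3 : ~~ (3 %| y) by move: hxy; rewrite /schur_rel; lia.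
  have hg : if s is y' :: _ then y' + 3 <= y else true.
    by case: (s) hp => //= y' s' /andP[]; rewrite /schur_rel; lia.
  (* Writing [y] as a sum certifies that the truncated subtraction in [dec] is exact. *)
  have [z ez [hz hc ht]] : exists2 z, y = z + 3 * size T + 6 * size Z &
     [/\ is_true (if Z is z' :: _ then z' <= z else true), c <= z & pair_on_top T z].
    exists (y - 3 * size T - 6 * size Z); move: hg hcT hcZ; rewrite -E;
     case: (enc_spec T Z) => [[? ?]|[t [T' [? h]]]|[z [Z' [? h]]]]; subst.
    - by move=> _ _ _ /=; lia.
    - rewrite enc_single //= => hg /andP[hct _] _.
      by case: (Z) h hg => [|z' Z'] /=; lia.
    - by rewrite enc_pair //=; case: (T) h => [|t T'] /=; lia.
    - by split=> //=; lia.
    - rewrite enc_single //= => hg /andP[hct _] _.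
      by case: (Z) h hg => [|z' Z'] /=; split=> //; lia.
    - rewrite enc_pair //= => hg _ /andP[hcz _].
      by case: (T) h hg => [|t T'] /=; split=> //; lia.
  have -> : y - 3 * size T - 6 * size Z = z by clear -ez; lia.
  rewrite /is_code sorted_geq_cons /= hT hZ hz hc hcT hcZ enc_pair // E h3 !andbT.
  by split=> //; [clear -hy3 ez; lia | rewrite -ez -exy].
have [] := IH (y :: s) _ _ hp; [by []|by rewrite /= hy|].
rewrite -/(dec (y :: s)).
case: (dec (y :: s)) => T Z /= /and3P[/= hT hZ h3] E hcT hcZ.
have hg : y + 4 <= x by move: hxy; rewrite /schur_rel; lia.
have [t et [ht hc hz]] : exists2 t, x = t + 4 * size T + 6 * size Z &
   [/\ is_true (if T is t' :: _ then t' <= t else true), c <= t & single_on_top t T Z].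
  exists (x - 4 * size T - 6 * size Z); move: E hcT hcZ;
   case: (enc_spec T Z) => [[? ?]|[t [T' [? h]]]|[z [Z' [? h]]]]; subst => //.
  - by rewrite enc_single //= => -[]; lia.
  - by rewrite enc_pair //= => -[]; case: (T) h => [|t T'] /=; lia.
  - rewrite enc_single //= => -[] + _ /andP[hct _] _.
    by case: (Z) h => [|z' Z'] /=; split=> //; lia.
  - rewrite enc_pair //= => -[] + _ + /andP[hcz _].
    by case: (T) h => [|t T'] /=; [|move=> ? ? /andP[]]; split=> //; lia.
have -> : x - 4 * size T - 6 * size Z = t by clear -et; lia.
rewrite /is_code sorted_geq_cons /= hT hZ ht hc hcT hcZ h3; split=> //.
by rewrite -[LHS]/(enc (t :: T) Z) enc_single // E -et.
Qed.

Lemma enc_all_geq c T Z : all (leq c) T -> all (leq c) Z -> all (leq c) (enc T Z).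
Proof.
move: T Z; apply: enc_ind => // [t T Z hz IH|T z Z hz IH].
  by rewrite enc_single //= => /andP[ht hT] hZ; rewrite IH // andbT; lia.
by rewrite enc_pair //= => hT /andP[h hZ]; rewrite IH // andbT; lia.
Qed.

(** Singles are shifted by even amounts, and a pair has one odd and one even part. *)
Lemma count_parity_enc T Z :
  count odd (enc T Z) = count odd T + size Z /\
  count even (enc T Z) = count even T + size Z.
Proof.
move: T Z; apply: enc_ind => // [t T Z hz [IH1 IH2]|T z Z hz [IH1 IH2]].
  by rewrite enc_single //= IH1 IH2 /even; lia.
by rewrite enc_pair //= IH1 IH2 /even; lia.
Qed.

(** The interleaving does not affect the sum: a single and a pair contribute 6 either way, since a
    single on top is raised by 6 and a pair on top by 3 in each part. *)
Lemma sumn_enc T Z :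
  sumn (enc T Z) + 2 * size T + 3 * size Z =
  sumn T + 2 * sumn Z + 2 * size T ^ 2 + 6 * size T * size Z + 6 * size Z ^ 2.
Proof.
by move: T Z; apply: enc_ind => // [t T Z hz IH|T z Z hz IH];
  rewrite (enc_single, enc_pair) //=; move: IH; nia.
Qed.

(** * Counting the parts in pairs along maximal progressions *)

Definition gap3 (a b : nat) : bool := b + 3 <= a.

Lemma maxprog3P s a l :
  reflect [/\ 0 < l, forall i, i < l -> a + 3 * i \in s,
              a + 3 * l \notin s & forall y, y + 3 = a -> y \notin s]
          (maxprog3 s a l).
Proof.
apply: (iffP and4P) => -[h1 h2 h3 h4]; split=> //.
- by move=> i hi; apply: (allP h2); rewrite mem_iota.
- by move=> y E; apply: contra h4 => hy; apply/mapP; exists y.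
- by apply/allP => i; rewrite mem_iota => /andP[_ hi]; apply: h2.
- by apply/mapP => -[y hy E]; move: (h4 y (esym E)); rewrite hy.
Qed.

Lemma maxprog3_size s a l : maxprog3 s a l -> l <= size s.
Proof.
case/maxprog3P=> _ h _ _.
rewrite -(size_iota 0 l) -(size_map (fun i => a + 3 * i)).
apply: uniq_leq_size.
  by rewrite map_inj_uniq ?iota_uniq // => i j /=; lia.
by move=> x /mapP[i]; rewrite mem_iota => /andP[_ hi] ->; apply: h.
Qed.

Lemma min_odd_progP s x :
  reflect (exists l, odd l /\ maxprog3 s x l) (min_odd_prog s x).
Proof.
apply: (iffP existsP) => [[l /andP[h1 h2]]|[l [h1 h2]]]; first by exists l.
have hl : l < (size s).+1 by rewrite ltnS (maxprog3_size h2).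
by exists (Ordinal hl); rewrite /= h1.
Qed.

Lemma max_odd_progP s x :
  reflect (exists a l, [/\ odd l, maxprog3 s a l & x = a + 3 * l.-1])
          (max_odd_prog s x).
Proof.
apply: (iffP hasP) => [[a _ /existsP[l /and3P[h1 h2 /eqP h3]]]|[a [l [h1 h2 h3]]]].
  by exists a, l.
have hl : l < (size s).+1 by rewrite ltnS (maxprog3_size h2).
exists a; last by apply/existsP; exists (Ordinal hl); rewrite /= h1 h2 h3 eqxx.
by case/maxprog3P: h2 => /[dup] l0 _ /(_ 0 l0); rewrite muln0 addn0.
Qed.

(* [b = true] gives upper pairs, [b = false] lower pairs. *)
Definition in_pair (b : bool) (s : seq nat) (x : nat) : bool :=
  [&& x \in s, has_neighbour s x,
      ~~ ((odd x == b) && max_odd_prog s x) &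
      ~~ ((odd x != b) && min_odd_prog s x)].

(** For odd [l] both ends of the progression have the parity of [a], so exactly one of the two
    exceptions applies, and [odd a == b] tells whether it removes the top or the bottom. *)
Lemma in_pair_prog b s a l i : maxprog3 s a l -> i < l ->
  in_pair b s (a + 3 * i) =
  (1 < l) && ~~ (odd l && (i == if odd a == b then l.-1 else 0)).
Proof.
move=> h hi; case/maxprog3P: (h) => l0 hin hup hdn.
(* Maximal progressions sharing an element coincide: otherwise one would extend the other. *)
have Hmax : max_odd_prog s (a + 3 * i) = odd l && (i == l.-1).
  apply/max_odd_progP/andP => [[a' [l' [ol' h' E]]]|[ol /eqP Ei]]; last first.
    by exists a, l; rewrite Ei.
  case/maxprog3P: h' => l0' hin' hup' hdn'.
  have Ei : i = l.-1.
    case: (ltngtP i l.-1) => // hi'; last by lia.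
    have: a + 3 * i.+1 \in s by apply: hin; lia.
    by rewrite (_ : _ + _ = a' + 3 * l') ?(negPf hup') //; lia.
  rewrite Ei eqxx; suff -> : l = l' by [].
  case: (ltngtP l l') => // hl.
    have: a' + 3 * (l' - l).-1 \in s by apply: hin'; lia.
    by rewrite (negPf (hdn _ _)) //; lia.
  have: a + 3 * (l - l').-1 \in s by apply: hin; lia.
  by rewrite (negPf (hdn' _ _)) //; lia.
have Hmin : min_odd_prog s (a + 3 * i) = odd l && (i == 0).
  apply/min_odd_progP/andP => [[l' [ol' h']]|[ol /eqP ->]]; last first.
    by exists l; rewrite muln0 addn0.
  case/maxprog3P: h' => l0' hin' hup' hdn'.
  have Ei : i = 0.
    case: i hi hin' hup' hdn' {Hmax} => // i hi _ _ /(_ (a + 3 * i)).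
    by rewrite hin; [move/(_ _)/negP; case; lia|lia].
  rewrite Ei eqxx; suff -> : l = l' by []; subst i.
  case: (ltngtP l l') => // hl.
    by move: hup; rewrite (_ : a + 3 * l = a + 3 * 0 + 3 * l) ?hin' //; lia.
  by move: hup'; rewrite (_ : a + 3 * 0 + 3 * l' = a + 3 * l') ?hin //; lia.
have Hn : has_neighbour s (a + 3 * i) = (1 < l).
  apply/orP/idP => [[H|/mapP[y hy E]]|hl].
  - case: (ltngtP i.+1 l) => //; try lia; move=> El.
    by move: hup; rewrite -El (_ : a + 3 * i.+1 = a + 3 * i + 3) ?H //; lia.
  - case: i hi E {Hmax Hmin} => [|i]; last by lia.
    by move=> _ E; move: (hdn y); rewrite hy => /(_ _)/negP; case; lia.
  - case: (ltngtP i.+1 l) => H; [left| lia |right].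
      by rewrite (_ : _ + 3 = a + 3 * i.+1) ?hin //; lia.
    apply/mapP; exists (a + 3 * i.-1); last by lia.
    by apply: hin; lia.
rewrite /in_pair hin // Hmax Hmin Hn /=.
case: ltngtP => //= hl; case: (boolP (odd l)) => //= ol; last by rewrite !andbF.
by case: (boolP (odd a == b)) => /eqP oa; case: (eqVneq i l.-1) => ei;
  case: (eqVneq i 0) => e0; lia.
Qed.

Fixpoint block (a l : nat) : seq nat :=
  if l is l'.+1 then a + 3 * l' :: block a l' else [::].

Lemma mem_block a l x : (x \in block a l) = [exists i : 'I_l, x == a + 3 * i].
Proof.
elim: l => [|l IH] /=; first by rewrite in_nil; apply/esym/existsP => -[[]].
rewrite inE IH; apply/idP/existsP => [/predU1P[->|/existsP[i hi]]|[i /eqP ->]].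
- by exists ord_max; rewrite /=.
- by exists (widen_ord (leqnSn l) i).
- case: (ltngtP i l) => hi; last by rewrite hi eqxx.
    by apply/orP; right; apply/existsP; exists (Ordinal hi).
  by have := ltn_ord i; lia.
Qed.

Lemma count_block P a l : count P (block a l) = count (fun i => P (a + 3 * i)) (iota 0 l).
Proof.
elim: l => // l IH; rewrite -addn1 iotaD count_cat -IH add0n addn1 /=; lia.
Qed.

(** The descent by steps of 3 from the top part stops at the first larger gap, which separates the
    block from all that follows. *)
Lemma block_decomp x s : sorted gap3 (x :: s) ->
  exists a l s', [/\ x :: s = block a l.+1 ++ s',
    all (fun y => y + 3 < a) s' & sorted gap3 s'].
Proof.
have tr : transitive gap3 by move=> ? ? ?; rewrite /gap3; lia.
elim: s x => [|y s IH] x /=; first by exists x, 0, [::]; rewrite /= muln0 addn0.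
case/andP=> hxy hs; case: (eqVneq x (y + 3)) => [Ex|ne].
  have [a [l [s' [E h1 h2]]]] := IH y hs; exists a, l.+1, s'; split=> //.
  by rewrite E /= Ex; case: E => -> _; congr (_ :: _); lia.
exists x, 0, (y :: s); split=> //; first by rewrite /= muln0 addn0.
have := order_path_min tr hs; rewrite /=; move: hxy ne; rewrite /gap3 => hxy ne h.
apply/andP; split; first by lia.
by apply: sub_all h => z; lia.
Qed.

(** Progressions and neighbours move by steps of 3 and cannot cross the larger gap below [a]. *)
Lemma in_pair_rest b a l s x : all (fun y => y + 3 < a) s -> x \in s ->
  in_pair b (block a l ++ s) x = in_pair b s x.
Proof.
move=> hs hx.
have hblk z : z \in block a l -> a <= z.
  by rewrite mem_block => /existsP[i /eqP ->]; lia.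
have hlt z : z < a -> (z \in block a l ++ s) = (z \in s).
  move=> hz; rewrite mem_cat; case: (boolP (z \in block a l)) => // /hblk; lia.
have up z : z \in s -> (z + 3 \in block a l ++ s) = (z + 3 \in s).
  by move=> hz; apply: hlt; have := allP hs z hz.
have mp a' l' : a' \in s -> maxprog3 (block a l ++ s) a' l' = maxprog3 s a' l'.
  move=> ha'; have ha := allP hs a' ha'.
  apply/maxprog3P/maxprog3P => -[h1 h2 h3 h4].
    have H i : i < l' -> a' + 3 * i \in s.
      elim: i => [|i IH] hi; first by rewrite muln0 addn0.
      have hi' := IH (ltnW hi); have := h2 _ hi.
      by rewrite (_ : a' + 3 * i.+1 = a' + 3 * i + 3) ?up //; lia.
    have Hl : a' + 3 * l' < a by have := allP hs _ (H l'.-1 _); rewrite /=; lia.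
    split=> // [|y E]; first by rewrite -hlt.
    by rewrite -hlt ?h4 //; lia.
  have Hl : a' + 3 * l' < a by have := allP hs _ (h2 l'.-1 _); rewrite /=; lia.
  split=> // [i hi||y E]; first by rewrite hlt ?h2 //; lia.
    by rewrite hlt.
  by rewrite hlt ?h4 //; lia.
have hxa := allP hs x hx.
rewrite /in_pair mem_cat hx orbT /=; congr [&& _, ~~ (_ && _) & ~~ (_ && _)].
- rewrite /has_neighbour up //; congr (_ || _).
  by apply/mapP/mapP => -[y hy E]; exists y => //; move: hy; rewrite hlt //; lia.
- apply/max_odd_progP/max_odd_progP => -[a' [l' [h1 h2 h3]]]; exists a', l'; split=> //.
    rewrite -mp //; case/maxprog3P: h2 => l0 /(_ 0 l0); rewrite muln0 addn0.
    by rewrite hlt //; lia.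
  rewrite mp //; case/maxprog3P: h2 => l0 /(_ 0 l0); rewrite muln0 addn0.
  by [].
- by apply/min_odd_progP/min_odd_progP => -[l' [h1 h2]]; exists l'; rewrite ?mp // -?mp.
Qed.

Lemma maxprog3_block a l s : all (fun y => y + 3 < a) s ->
  maxprog3 (block a l.+1 ++ s) a l.+1.
Proof.
move=> hs; have hout z : a <= z -> z \notin s.
  by move=> hz; apply/negP => /(allP hs); lia.
apply/maxprog3P; split=> // [i hi||y E]; rewrite mem_cat mem_block.
- by apply/orP; left; apply/existsP; exists (Ordinal hi).
- rewrite negb_or hout ?andbT; last by lia.
  by apply/existsP => -[i /eqP]; have := ltn_ord i; lia.
- rewrite negb_or; apply/andP; split.
    by apply/existsP => -[i /eqP]; lia.
  by apply/negP => /(allP hs); lia.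
Qed.

(** The greedy pairing consumes the block two by two from the top; for odd [l] the leftover is [a],
    too far from [s] to be paired. *)
Lemma pairs_block (r a l : nat) s : all (fun y => y + 3 < a) s ->
  count (fun x => x == r %[mod 3]) (pairs (block a l ++ s)) =
  l./2 * (a == r %[mod 3]) + count (fun x => x == r %[mod 3]) (pairs s).
Proof.
move=> hs; have [n] := ubnP l; elim: n l => // n IH [|[|l]] // hl.
  rewrite /= muln0 addn0; case: s hs {IH} => //= y s /andP[h _].
  by rewrite ifN //; lia.
rewrite [block _ _]/= [pairs _]/= ifT; last by lia.
rewrite /= IH; last by lia.
rewrite mulSn addnA; congr (nat_of_bool _ + _ + _); lia.
Qed.

Lemma count_pred1_iota n j : j < n -> count (fun i => i != j) (iota 0 n) = n.-1.
Proof.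
move=> hj; have := count_predC (pred1 j) (iota 0 n).
rewrite count_uniq_mem ?iota_uniq // mem_iota hj size_iota /= => E.
by rewrite -[in RHS]E.
Qed.

(** A progression of odd length loses one end and one of even length none, so the number of paired
    parts does not depend on [b]. This makes upper and lower pairs comparable. *)
Lemma count_in_pair b r s : sorted gap3 s ->
  count (fun x => in_pair b s x && (x == r %[mod 3])) s =
  2 * count (fun x => x == r %[mod 3]) (pairs s).
Proof.
have [n] := ubnP (size s); elim: n s => // n IH [|x s] // hn.
move=> /block_decomp [a [l [s' [E h1 h2]]]].
have {hn} hn : size s' < n by move: hn; rewrite E size_cat /=; lia.
rewrite E count_cat pairs_block // mulnDr -IH //.
congr (_ + _); last by apply: eq_in_count => y hy; rewrite in_pair_rest.
have hm := maxprog3_block l h1.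
rewrite count_block.
(* The index of the end left out when the length [l.+1] is odd. *)
set j := if odd a == b then l else 0.
have hj : j < l.+1 by rewrite /j; case: ifP.
rewrite (@eq_in_count _ _ (fun i : nat =>
   [&& a == r %[mod 3], 0 < l & ~~ (odd l.+1 && (i == j))])); last first.
  move=> i; rewrite mem_iota => /andP[_ hi]; rewrite (in_pair_prog _ hm) //.
  by rewrite andbC andbA (_ : (_ == _) = (a == r %[mod 3])) -?andbA //; lia.
have [ar|ar] := boolP (a == r %[mod 3]); last first.
  by rewrite (@eq_count _ _ pred0) ?count_pred0 ?muln0.
have [l00|l0] := posnP l.
  by rewrite (@eq_count _ _ pred0) ?count_pred0 ?l00.
have [ol|ol] := boolP (odd l.+1); last first.
  by rewrite (@eq_count _ _ predT) // count_predT size_iota; lia.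
by rewrite [LHS](count_pred1_iota hj); lia.
Qed.

(** * Codes with the part 3 or 1 set apart *)

Lemma schur_rel_trans : transitive schur_rel.
Proof. by move=> y x z; rewrite /schur_rel; lia. Qed.

Lemma schur_rel_gap3 s : sorted schur_rel s -> sorted gap3 s.
Proof. by apply: sub_sorted => x y /andP[]. Qed.

Lemma is_schurE s : is_schur s = all (leq 1) s && sorted schur_rel s.
Proof.
rewrite /is_schur /is_partition.
case: (boolP (sorted schur_rel s)) => hs; last by rewrite !andbF.
rewrite !andbT (sub_sorted _ hs) // => x y /andP[h _].
exact: leq_trans (leq_addr _ _) h.
Qed.

(** Transitivity of [schur_rel] turns the condition on neighbours into one on all pairs of parts. *)
Lemma sorted_schur_tail s (fl : bool) d :
  sorted schur_rel (s ++ nseq fl d) =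
  sorted schur_rel s && (fl ==> all (schur_rel^~ d) s).
Proof.
rewrite !(sorted_pairwise schur_rel_trans) pairwise_cat.
by case: fl; rewrite /= ?cats0 ?allrel1r ?allrel0r ?andbT //= andbC.
Qed.

Lemma filter_tail s (fl : bool) d :
  all (ltn d) s -> filter (ltn d) (s ++ nseq fl d) = s.
Proof.
move=> hs; rewrite filter_cat (all_filterP hs).
by case: fl; rewrite /= ?ltnn cats0.
Qed.

Lemma mem_tail s (fl : bool) d : all (ltn d) s -> (d \in s ++ nseq fl d) = fl.
Proof.
move=> hs; rewrite mem_cat mem_nseq eqxx andbT lt0b.
by case: (boolP (d \in s)) => // /(allP hs) /=; rewrite ltnn.
Qed.

Lemma tail_decomp d s : all (leq d) s -> sorted schur_rel s ->
  s = filter (ltn d) s ++ nseq (d \in s) d.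
Proof.
move=> hd; rewrite (sorted_pairwise schur_rel_trans).
elim: s hd => //= x s IH /andP[hx hs] /andP[hxs hp].
rewrite inE; case: (eqVneq d x) => [E|ne] /=.
  case: s hs hxs {IH hp} => [|y s] /=; first by rewrite E ltnn.
  by rewrite /schur_rel; lia.
have -> : d < x by lia.
by rewrite cat_cons -IH.
Qed.

Definition code := (bool * (seq nat * seq nat))%type.

(* The flag records the part [d], which is 3 on the source side and 1 on the
   target side; it is set apart because 1 is never in a lower pair. *)
Definition encode (d : nat) (c : code) : seq nat :=
  enc c.2.1 c.2.2 ++ nseq c.1 d.

Definition decode (d : nat) (s : seq nat) : code :=
  (d \in s, dec (filter (ltn d) s)).

(** In the source ([c0 = 5]) parts other than 3 are at least 5, and at least 7 if 3 is present, as 6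
    and 3 are both multiples of 3. In the target ([c0 = 2]) parts other than 1 are at least 2, and
    at least 4 if 1 is present. Hence the term [2 * c.1]. *)
Definition code_from (c0 : nat) (c : code) : bool :=
  [&& is_code c.2, all (leq (c0 + 2 * c.1)) c.2.1 & all (leq (c0 + 2 * c.1)) c.2.2].

Definition parts_from (c0 d : nat) (s : seq nat) : bool :=
  all (fun x => (d == x) || (c0 + 2 * (d \in s) <= x)) s && sorted schur_rel s.

Lemma decode_correct c0 d s : d < c0 -> parts_from c0 d s ->
  code_from c0 (decode d s) /\ encode d (decode d s) = s.
Proof.
move=> hd /andP[h1 h2].
have hs : all (leq d) s by apply: sub_all h1 => x; lia.
have hf : all (leq (c0 + 2 * (d \in s))) (filter (ltn d) s).
  apply/allP => x; rewrite mem_filter => /andP[hx xs].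
  by have := allP h1 x xs; move: hx => /=; lia.
have [] := dec_correct hf (sorted_filter schur_rel_trans _ h2).
rewrite /code_from /encode /= => -> -> -> ->.
by rewrite -tail_decomp.
Qed.

Lemma encode_correct c0 d c : d < c0 ->
  (forall x, c0 + 2 <= x -> schur_rel x d) -> code_from c0 c ->
  parts_from c0 d (encode d c) /\ decode d (encode d c) = c.
Proof.
case: c => fl [T Z] hd hr /and3P[/= hc hT hZ].
have hs := enc_all_geq hT hZ; have [h1 h2 _] := enc_correct hc.
have hlt : all (ltn d) (enc T Z) by apply: sub_all hs => x /=; lia.
rewrite /parts_from /encode /decode /= filter_tail // mem_tail // h2; split=> //.
rewrite sorted_schur_tail h1 /= all_cat -andbA; apply/and3P; split.
- by apply: sub_all hs => x ->; rewrite orbT.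
- by apply/allP => x; rewrite mem_nseq => /andP[_ /eqP->]; rewrite eqxx.
- by apply/implyP => hfl; apply: sub_all hs => x; rewrite hfl => /hr.
Qed.

Lemma encode_stat d c : odd d ->
  [/\ odd_parts (encode d c) = count odd c.2.1 + size c.2.2 + c.1,
      even_parts (encode d c) = count even c.2.1 + size c.2.2 &
      sumn (encode d c) = sumn (enc c.2.1 c.2.2) + d * c.1].
Proof.
case: c => fl [T Z] hd; rewrite /odd_parts /even_parts /encode /= !count_cat.
have [-> ->] := count_parity_enc T Z.
rewrite sumn_cat sumn_nseq !count_nseq /even hd mul1n mul0n addn0; split=> //.
Qed.

Lemma source_parts s :
  is_schur s && min_parts s = parts_from 5 3 s.
Proof.
rewrite is_schurE /parts_from -andbA andbC -andbA andbC.
case: (boolP (sorted schur_rel s)) => hs; rewrite ?andbT ?andbF //.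
rewrite /min_parts; apply/andP/allP => [[/allP hm /allP h1] x xs|h].
  have := hm x xs; case: (boolP (3 \in s)) => [s3|_]; last by case: ifP; lia.
  case: (eqVneq 3 x) => //= ne.
  have h3 : all (leq 3) s by apply/allP => y /hm; case: ifP; lia.
  have := hs; rewrite (tail_decomp h3 hs) s3 sorted_schur_tail => /andP[_ /= /allP/(_ x)].
  rewrite mem_filter xs andbT /schur_rel; have := allP h3 x xs => /= h3x.
  by move/(_ _); case: ifP; lia.
by split; apply/allP => x /h; [case: ifP|]; lia.
Qed.

Lemma target_parts s : is_schur s = parts_from 2 1 s.
Proof.
rewrite is_schurE /parts_from; case: (boolP (sorted schur_rel s)) => hs; rewrite ?andbF //.
rewrite !andbT; apply/idP/allP => [h1 x xs|h]; last by apply/allP => x /h; lia.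
have := allP h1 x xs; case: (boolP (1 \in s)) => [s1|_]; last by lia.
case: (eqVneq 1 x) => //= ne h1x.
have := hs; rewrite (tail_decomp h1 hs) s1 sorted_schur_tail => /andP[_ /= /allP/(_ x)].
by rewrite mem_filter xs andbT /schur_rel /=; lia.
Qed.

Lemma in_pair_upper s x : in_upper_pair s x = in_pair true s x.
Proof. by rewrite /in_pair /in_upper_pair eqb_id /even; case: (odd x). Qed.

(** The greedy pairing could use the final [d] only together with [d + 3]. *)
Lemma pairs_tail s (fl : bool) d :
  d + 3 \notin s -> pairs (s ++ nseq fl d) = pairs s.
Proof.
case: fl => [|_]; last by rewrite cats0.
have [n] := ubnP (size s); elim: n s => // n IH [|x [|y s]] //= hn.
  by rewrite inE => hd; rewrite ifN // eq_sym.
rewrite !inE !negb_or => /and3P[_ hy hs].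
have := IH (y :: s); rewrite /= inE negb_or hy => -> //.
by have -> : pairs (s ++ [:: d]) = pairs s by exact: IH (ltnW hn) hs.
Qed.

Lemma upper_count_encode r c : code_from 5 c ->
  upper_count r (encode 3 c) = 2 * count (fun z => z == r %[mod 3]) c.2.2.
Proof.
move=> hc; have [] := encode_correct (d := 3) _ _ hc => //.
  by move=> x; rewrite /schur_rel; lia.
case: c hc => fl [T Z] /and3P[/= hc hT hZ] /andP[hp hs] _; rewrite /upper_count.
rewrite (eq_count (a2 := fun x => in_pair true (encode 3 (fl, (T, Z))) x && (x == r %[mod 3]))).
  2: by move=> x; rewrite in_pair_upper.
rewrite count_in_pair; last exact: schur_rel_gap3.
congr (2 * _); have [_ _ E] := enc_correct hc.
have <- : count (pred1 (r %% 3)) (map (modn^~ 3) Z) = count (fun z => z == r %[mod 3]) Z.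
  by rewrite count_map.
rewrite -E count_map /encode /=; case: fl hs hp hT hZ => [|] hs hp hT hZ; last by rewrite cats0.
(* With the part 3 present all other parts are at least 7, so 6 is absent. *)
rewrite (pairs_tail true) //; apply/negP => /(allP (enc_all_geq hT hZ)); lia.
Qed.

(** Only [x = 4] can gain a neighbour, from the part 1. If it has no other, it forms a progression
    of length 1 among the parts greater than 1 and, being even, is excluded. *)
Lemma in_pair_lower s (fl : bool) x : all (leq (2 + 2 * fl)) s -> x \in s ->
  in_lower_pair (s ++ nseq fl 1) x = in_pair false s x.
Proof.
move=> hs xs; have h1 : all (ltn 1) s by apply: sub_all hs => y /=; lia.
have x1 : 1 < x := allP h1 x xs.
rewrite /in_lower_pair (filter_tail _ h1) /in_pair mem_cat xs x1 /=.
rewrite eqbF_neg negbK -/(even x).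
have -> : has_neighbour (s ++ nseq fl 1) x = has_neighbour s x || fl && (x == 4).
  rewrite /has_neighbour mem_cat map_cat mem_cat map_nseq !mem_nseq.
  by move: (x + 3 \in s) (x \in map _ s) => b1 b2; case: (fl) => /=; lia.
case: (boolP (has_neighbour s x)) => //= hn.
case: (boolP (fl && _)) => //= /andP[hfl /eqP x4].
suff -> : max_odd_prog s x by rewrite x4.
apply/max_odd_progP; exists x, 1; split=> //; last by lia.
move: hn; rewrite /has_neighbour negb_or => /andP[hu hd].
by rewrite /maxprog3 /= !muln0 !addn0 muln1 xs hu hd.
Qed.

Lemma lower_count_encode r c : code_from 2 c ->
  lower_count r (encode 1 c) = 2 * count (fun z => z == r %[mod 3]) c.2.2.
Proof.
case: c => fl [T Z] /and3P[/= hc hT hZ]; rewrite /lower_count /encode /=.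
have hs := enc_all_geq hT hZ; have [h1 _ E] := enc_correct hc.
rewrite count_cat [X in _ + X]count_nseq {2}/in_lower_pair ltnn !andbF mul0n addn0.
rewrite (@eq_in_count _ _ (fun x => in_pair false (enc T Z) x && (x == r %[mod 3]))); last first.
  by move=> x xs; rewrite (in_pair_lower hs).
rewrite count_in_pair; last exact: schur_rel_gap3.
congr (2 * _).
have <- : count (pred1 (r %% 3)) (map (modn^~ 3) Z) = count (fun z => z == r %[mod 3]) Z.
  by rewrite count_map.
by rewrite -E count_map.
Qed.

(** * Shifting the codes *)

(** On entries at least 5 the parity is kept, so the inverse step knows which amount to restore. *)
Definition step_down (t : nat) : nat := if odd t then t - 2 else t - 4.
Definition step_up (t : nat) : nat := if odd t then t + 2 else t + 4.

(* The steps for odd and even singles differ, so the order of the singles has to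
   be restored. *)
Definition code_down (c : code) : code :=
  (c.1, (sort geq (map step_down c.2.1), map (subn^~ 3) c.2.2)).
Definition code_up (c : code) : code :=
  (c.1, (sort geq (map step_up c.2.1), map (addn^~ 3) c.2.2)).

Lemma geq_total : total geq.
Proof. by move=> x y; rewrite /geq /=; lia. Qed.

Lemma geq_trans : transitive geq.
Proof. by move=> y x z; rewrite /geq /=; lia. Qed.

Lemma geq_anti : antisymmetric geq.
Proof. by move=> x y; rewrite /geq /=; lia. Qed.

(** A sorted sequence is determined by its multiset, so the intermediate sorting does no harm. *)
Lemma sort_map_cancel (f g : nat -> nat) T : sorted geq T ->
  {in T, cancel f g} -> sort geq (map g (sort geq (map f T))) = T.
Proof.
move=> hT hfg; rewrite -[RHS](sorted_sort geq_trans hT).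
apply/(perm_sortP geq_total geq_trans geq_anti).
have -> : perm_eq (map g (sort geq (map f T))) T =
          perm_eq (map g (sort geq (map f T))) (map g (map f T)).
  by congr perm_eq; rewrite -map_comp -[LHS]map_id; apply/eq_in_map => t /hfg /= ->.
by apply: perm_map; rewrite perm_sort.
Qed.

Lemma code_down_correct c : code_from 5 c ->
  code_from 2 (code_down c) /\ code_up (code_down c) = c.
Proof.
case: c => fl [T Z] /and3P[/and3P[/= hT hZ h3] hcT hcZ]; split.
  rewrite /code_from /is_code /= sort_sorted ?all_sort; last exact: geq_total.
  rewrite !all_map sorted_map /= -andbA; apply/and4P; split.
  - by apply: sub_sorted hZ => x y /=; rewrite /geq /relpre /=; lia.
  - apply/allP => z zZ; have := allP hcZ z zZ; have := allP h3 z zZ; rewrite /=; lia.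
  - by apply: sub_all hcT => t; rewrite /step_down /=; case: ifP; lia.
  - by apply: sub_all hcZ => z /=; lia.
congr (_, (_, _)); rewrite /=.
  apply: sort_map_cancel => // t /(allP hcT) /= ht.
  by rewrite /step_down /step_up; case: (boolP (odd t)) => ot; case: ifP; lia.
rewrite -map_comp -[RHS]map_id; apply/eq_in_map => z /(allP hcZ) /= hz.
by rewrite subnK //; lia.
Qed.

Lemma code_up_correct c : code_from 2 c ->
  code_from 5 (code_up c) /\ code_down (code_up c) = c.
Proof.
case: c => fl [T Z] /and3P[/and3P[/= hT hZ h3] hcT hcZ]; split.
  rewrite /code_from /is_code /= sort_sorted ?all_sort; last exact: geq_total.
  rewrite !all_map sorted_map /= -andbA; apply/and4P; split.
  - by apply: sub_sorted hZ => x y /=; rewrite /geq /relpre /=; lia.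
  - by apply: sub_all h3 => z /=; lia.
  - by apply: sub_all hcT => t; rewrite /step_up /=; case: ifP; lia.
  - by apply: sub_all hcZ => z /=; lia.
congr (_, (_, _)); rewrite /=.
  apply: sort_map_cancel => // t /(allP hcT) /= ht.
  by rewrite /step_down /step_up; case: (boolP (odd t)) => ot; case: ifP; lia.
rewrite -map_comp -[RHS]map_id; apply/eq_in_map => z /(allP hcZ) /= hz.
by rewrite addnK.
Qed.

(** The numbers of singles and pairs are kept, so the quadratic terms of [sumn_enc] cancel. An odd
    single loses 2, an even one 4, a pair 6 = 2 + 4, and the part set apart 3 - 1 = 2: in total 2
    for each odd and 4 for each even part. *)
Lemma code_down_stat c : code_from 5 c ->
  [/\ odd_parts (encode 1 (code_down c)) = odd_parts (encode 3 c),
      even_parts (encode 1 (code_down c)) = even_parts (encode 3 c),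
      forall r, lower_count r (encode 1 (code_down c)) = upper_count r (encode 3 c) &
      sumn (encode 1 (code_down c))
        + 2 * (odd_parts (encode 3 c) + 2 * even_parts (encode 3 c))
      = sumn (encode 3 c)].
Proof.
move=> hc; have [hd _] := code_down_correct hc.
have [-> -> ->] := encode_stat (code_down c) (isT : odd 1).
have [-> -> ->] := encode_stat c (isT : odd 3).
case: c hc hd => fl [T Z] hc hd /=.
have /and3P[_ hcT hcZ] := hc; rewrite /= in hcT hcZ.
have pT : perm_eq (sort geq (map step_down T)) (map step_down T) by rewrite perm_sort.
have Eo : count odd (sort geq (map step_down T)) = count odd T.
  rewrite (permP pT) count_map; apply: eq_in_count => t /(allP hcT) /= ht.
  by rewrite /step_down; case: ifP; lia.
have Ee : count even (sort geq (map step_down T)) = count even T.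
  rewrite (permP pT) count_map; apply: eq_in_count => t /(allP hcT) /= ht.
  by rewrite /step_down /even; case: ifP; lia.
have Es : sumn (sort geq (map step_down T)) + 2 * count odd T + 4 * count even T = sumn T.
  rewrite (perm_sumn pT); elim: (T) hcT => //= t T' IH /andP[ht /IH <-].
  by rewrite /step_down /even; case: ifP; lia.
have EZ : sumn (map (subn^~ 3) Z) + 3 * size Z = sumn Z.
  by elim: (Z) hcZ => //= z Z' IH /andP[hz /IH <-]; lia.
split; rewrite ?Eo ?Ee ?size_map //.
  move=> r; rewrite lower_count_encode // upper_count_encode //=; congr (2 * _).
  by rewrite count_map; apply: eq_in_count => z /(allP hcZ) /= hz; lia.
have := sumn_enc (sort geq (map step_down T)) (map (subn^~ 3) Z).
have := sumn_enc T Z; rewrite size_sort !size_map; lia.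
Qed.

(** * The bijection on partitions and the two statements *)

Definition psi (s : seq nat) : seq nat := encode 1 (code_down (decode 3 s)).
Definition psi_inv (s : seq nat) : seq nat := encode 3 (code_up (decode 1 s)).

Lemma psi_correct s : is_schur s -> min_parts s ->
  [/\ is_schur (psi s), psi_inv (psi s) = s,
      odd_parts (psi s) = odd_parts s & even_parts (psi s) = even_parts s] /\
  (forall r, lower_count r (psi s) = upper_count r s) /\
  sumn (psi s) + 2 * (odd_parts s + 2 * even_parts s) = sumn s.
Proof.
move=> h1 h2; have hs : parts_from 5 3 s by rewrite -source_parts h1.
have [hc Ec] := decode_correct (isT : 3 < 5) hs.
have [hd Ed] := code_down_correct hc.
have [] := code_down_stat hc; rewrite Ec -/(psi s) => -> -> hl hsum.
have [hp Ep] : parts_from 2 1 (psi s) /\ decode 1 (psi s) = code_down (decode 3 s).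
  by apply: encode_correct hd => // x; rewrite /schur_rel; lia.
by rewrite target_parts hp /psi_inv Ep Ed Ec.
Qed.

Lemma psi_inv_correct s : is_schur s ->
  [/\ is_schur (psi_inv s), min_parts (psi_inv s) & psi (psi_inv s) = s].
Proof.
rewrite target_parts => hs.
have [hc Ec] := decode_correct (isT : 1 < 2) hs.
have [hd Ed] := code_up_correct hc.
have [hp Ep] : parts_from 5 3 (psi_inv s) /\ decode 3 (psi_inv s) = code_up (decode 1 s).
  by apply: encode_correct hd => // x; rewrite /schur_rel; lia.
by move: hp; rewrite -source_parts /psi Ep Ed Ec => /andP[].
Qed.

(** Boolean predicates have unique proofs, so it suffices to compare the underlying elements. *)
Lemma sub_bijective (A : eqType) (P Q : pred A) (f g : A -> A) :
  (forall x, P x -> Q (f x) /\ g (f x) = x) ->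
  (forall y, Q y -> P (g y) /\ f (g y) = y) ->
  exists h : {x | P x} -> {y | Q y}, bijective h.
Proof.
move=> hf hg.
exists (fun u => exist Q (f (sval u)) (hf _ (svalP u)).1).
exists (fun v => exist P (g (sval v)) (hg _ (svalP v)).1) => u; apply: val_inj => /=.
  by case: (hf _ (svalP u)).
by case: (hg _ (svalP u)).
Qed.

(** Turns the loss in the sum under [psi] into twice [mstat s], so that the same map serves the
    second statement. *)
Lemma mstatE s : mstat s = odd_parts s + 2 * even_parts s.
Proof.
rewrite /mstat -(count_predC odd s) /odd_parts /even_parts.
by rewrite -[count (predC _) _]/(count even s); lia.
Qed.

Import GRing.Theory.
Local Open Scope ring_scope.

Theorem theorem3 :
  (forall w e p1 p2 n : nat,
     exists psi : Dstar_refined w e p1 p2 n%:Z ->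
                  D_refined w e p1 p2 (n%:Z - 2 * (w%:Z + 2 * e%:Z)),
       bijective psi)
  /\
  (forall m n : nat,
     exists psi : Dstar m n%:Z -> D m (n%:Z - 2 * m%:Z), bijective psi).
Proof.
(* One pair of maps serves both statements. The identity of sums holds in [nat], so a negative
   target number occurs only with an empty source. *)
split=> [w e p1 p2 n|m n]; apply: (@sub_bijective _ _ _ psi psi_inv) => s.
- move=> /and5P[/andP[h1 /eqP hn] h2 /eqP ho /eqP he /andP[/eqP hu1 /eqP hu2]].
  have [[h3 h4 Eo Ee] [hl hs]] := psi_correct h1 h2; split=> //.
  rewrite /is_schur_of h3 Eo Ee !hl ho he hu1 hu2 !eqxx !andbT /=.
  by apply/eqP; lia.
- move=> /and5P[/andP[h1 /eqP hn] /eqP ho /eqP he /eqP hu1 /eqP hu2].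
  have [h2 h3 h4] := psi_inv_correct h1; split=> //.
  have [[_ _ Eo Ee] [hl hs]] := psi_correct h2 h3; rewrite h4 in Eo Ee hl hs.
  rewrite /is_schur_of h2 h3 -Eo -Ee -!hl ho he hu1 hu2 !eqxx !andbT /=.
  by apply/eqP; lia.
- move=> /and3P[/andP[h1 /eqP hn] /eqP hm h2].
  have [[h3 h4 Eo Ee] [_ hs]] := psi_correct h1 h2; split=> //.
  rewrite /is_schur_of h3 !mstatE Eo Ee -mstatE hm eqxx andbT /=.
  by move: hm; rewrite mstatE => hm; apply/eqP; lia.
- move=> /andP[/andP[h1 /eqP hn] /eqP hm].
  have [h2 h3 h4] := psi_inv_correct h1; split=> //.
  have [[_ _ Eo Ee] [_ hs]] := psi_correct h2 h3; rewrite h4 in Eo Ee hs.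
  rewrite /is_schur_of h2 h3 !mstatE -Eo -Ee -mstatE hm eqxx /=.
  by move: hm; rewrite mstatE => hm; apply/eqP; lia.
Qed.
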